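(* Let $n\ge1$ and $a,k\in[2n]$. There exists a permutation $\sigma^{(a,k)}\in S_{2n}$ such that for every $P\in\mathcal{D}_n$, $u_{a,k}(P)=h_k\big(\sigma^{(a,k)}(P)\big)$.
   Context: A Dyck path of size $n$ is a word $P_1\cdots P_{2n}$ in $\mathtt{u},\mathtt{d}$ with $n$ of each letter whose every prefix has at least as many $\mathtt{u}$'s as $\mathtt{d}$'s; $\mathcal{D}_n$ is their set. The tunneling $\tau_P\in S_{2n}$ is the fixed-point-free involution pairing each up-step position with the position of its matching down-step. For $\sigma\in S_{2n}$, $\sigma_k=\sigma(k)$, $\sigma_{[k]}=\{\sigma_1,\dots,\sigma_k\}$; $\sigma(P)$ is the word with $\sigma(P)_k=\mathtt{u}$ if $\tau_P(\sigma_k)\notin\sigma_{[k]}$ and $\mathtt{d}$ otherwise. The height $h_k(P)$ is the number of $\mathtt{u}$'s minus the number of $\mathtt{d}$'s among $P_1,\dots,P_k$. For $S\subseteq[2n]$, a step $i\in S$ is unpaired in $S$ if $\tau_P(i)\notin S$. $u_{a,k}(P)$ is the number of unpaired steps in $I=\{a,a+1,\dots,a+k-1\}$ (indices modulo $2n$, in $[2n]$), i.e. among $k$ circularly consecutive steps of $P$ starting at step $a$. *)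

(* Defs.v *)
From mathcomp Require Import all_boot all_order all_fingroup all_algebra zify.
Set Implicit Arguments.
Unset Strict Implicit.
Unset Printing Implicit Defensive.
Import Order.TTheory GRing.Theory Num.Theory.

(* Words in u, d are boolean words, with u := true and d := false.  Positions
   are 0-based: the step P_(i+1) is nth false P i. *)

Definition height (w : seq bool) (k : nat) : int :=
  ((count_mem true (take k w))%:Z - (count_mem false (take k w))%:Z)%R.

Definition dyck (n : nat) : pred ((2 * n).-tuple bool) :=
  fun w => [&& count_mem true w == n, count_mem false w == n &
    [forall k : 'I_(2 * n).+1,
       count_mem false (take k w) <= count_mem true (take k w)]].

(* The up-step i is matched with the down-step j > i when the path returns to
   the height it had just before step i for the first time just after step j. *)
Definition matched (m : nat) (w : m.-tuple bool) (i j : 'I_m) : bool :=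
  [&& tnth w i, ~~ tnth w j, i < j, height w j.+1 == height w i &
    [forall l : 'I_m, (i < l <= j) ==> (height w i < height w l)%R]].

Lemma matched_inj_r m (w : m.-tuple bool) i j j' :
  matched w i j -> matched w i j' -> j = j'.
Proof.
case/and5P=> _ _ ij /eqP e /forallP H; case/and5P=> _ _ ij' /eqP e' /forallP H'.
apply/val_inj/eqP; rewrite /= eqn_leq; apply/andP; split; rewrite leqNgt.
  apply/negP => jj; have hb : j'.+1 < m by apply: leq_ltn_trans jj _.
  have := H (Ordinal hb); rewrite /= e' ltxx; lia.
apply/negP => jj; have hb : j.+1 < m by apply: leq_ltn_trans jj _.
have := H' (Ordinal hb); rewrite /= e ltxx; lia.
Qed.

Lemma matched_inj_l m (w : m.-tuple bool) i i' j :
  matched w i j -> matched w i' j -> i = i'.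
Proof.
case/and5P=> _ _ ij /eqP e /forallP H; case/and5P=> _ _ ij' /eqP e' /forallP H'.
have ee : height w i = height w i' by rewrite -e -e'.
apply/val_inj/eqP; rewrite /= eqn_leq; apply/andP; split; rewrite leqNgt.
  by apply/negP => jj; have := H' i; rewrite jj ltnW //= ee ltxx.
by apply/negP => jj; have := H i'; rewrite jj ltnW //= ee ltxx.
Qed.

Definition partner (m : nat) (w : m.-tuple bool) (i : 'I_m) : 'I_m :=
  odflt i [pick j | matched w i j || matched w j i].

Lemma partnerE m (w : m.-tuple bool) i j :
  matched w i j || matched w j i -> partner w i = j.
Proof.
move=> ij; rewrite /partner; case: pickP => [j' /= | /(_ j)]; last by rewrite ij.
have mm x y z : matched w x y -> matched w z x -> False.
  by move=> /andP[hx _] /and3P[_ /negP + _].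
case/orP: ij => ij /orP[] ij'.
- exact: matched_inj_r ij' ij.
- by case: (mm _ _ _ ij ij').
- by case: (mm _ _ _ ij' ij).
- exact: matched_inj_l ij' ij.
Qed.

Lemma partnerK m (w : m.-tuple bool) : involutive (partner w).
Proof.
move=> i; rewrite {2}/partner; case: pickP => [j /= ij | no /=].
  by apply: partnerE; rewrite orbC.
by rewrite /partner; case: pickP => // j; rewrite /= no.
Qed.

(* For a Dyck path every position has a partner (see tunneling_neq), so the
   default value in partner is irrelevant. *)
Definition tunneling (m : nat) (w : m.-tuple bool) : 'S_m :=
  perm (can_inj (@partnerK m w)).

Lemma tunnelingK m (w : m.-tuple bool) : involutive (tunneling w).
Proof. by move=> i; rewrite !permE partnerK. Qed.

Lemma height_recr m (w : m.-tuple bool) (i : 'I_m) :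
  height w i.+1 = (height w i + if tnth w i then 1 else -1)%R.
Proof.
rewrite /height (take_nth false) ?size_tuple // -tnth_nth.
rewrite -cats1 !count_cat /=; case: (tnth w i) => /=; lia.
Qed.

Lemma dyck_height_ge0 n w k : @dyck n w -> (0 <= height w k)%R.
Proof.
case/and3P=> /eqP a /eqP b /forallP h; rewrite /height subr_ge0 lez_nat.
case: (leqP k (2 * n)) => hk; first by apply: (h (Ordinal (hk : k < _.+1))).
by rewrite take_oversize ?a ?b // size_tuple ltnW.
Qed.

Lemma dyck_height_last n w : @dyck n w -> height w (2 * n) = 0%R.
Proof.
case/and3P=> /eqP a /eqP b _; rewrite /height take_oversize ?size_tuple //.
by rewrite a b subrr.
Qed.

Lemma dyck_matched n w (i : 'I_(2 * n)) :
  @dyck n w -> exists j, matched w i j || matched w j i.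
Proof.
move=> D; case wi: (tnth w i).
  have ex : exists l, (i < l) && (height w l <= height w i)%R.
    by exists (2 * n); rewrite ltn_ord dyck_height_last // dyck_height_ge0.
  case: (ex_minnP ex) => -[//|j] /andP[ij hj] jmin.
  have hi := height_recr w i; rewrite wi in hi.
  have jb : j < 2 * n.
    by apply: jmin; rewrite ltn_ord dyck_height_last // dyck_height_ge0.
  have low l : i < l <= j -> (height w i < height w l)%R.
    move=> /andP[il lj]; rewrite ltNge; apply/negP => hl.
    by have := jmin l; rewrite il hl => /(_ isT); lia.
  have neq : i < j.
    rewrite ltn_neqAle -ltnS ij andbT; apply/eqP => eij.
    by rewrite -eij in hj; lia.
  exists (Ordinal jb); rewrite /matched wi /= neq /=.
  have hr := height_recr w (Ordinal jb); rewrite /= in hr.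
  have lj := low j; rewrite neq leqnn in lj; have {}lj := lj isT.
  apply/orP; left; case: (tnth _ _) hr => hr /=; first by lia.
  apply/andP; split; first by apply/eqP; lia.
  by apply/forallP => l; apply/implyP; apply: low.
have hi := height_recr w i; rewrite wi in hi.
have ex : exists l, (l <= i) && (height w l <= height w i.+1)%R.
  by exists 0; rewrite /= {1}/height take0 /= dyck_height_ge0.
have ub l : (l <= i) && (height w l <= height w i.+1)%R -> l <= i by case/andP.
case: (ex_maxnP ex ub) => j /andP[ji hj] jmax.
have low l : j < l <= i -> (height w i.+1 < height w l)%R.
  move=> /andP[il lj]; rewrite ltNge; apply/negP => hl.
  by have := jmax l; rewrite lj hl => /(_ isT); lia.
have neq : j < i.
  by rewrite ltn_neqAle ji andbT; apply/eqP => eij; rewrite eij in hj; lia.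
have jb : j < 2 * n by apply: ltn_trans neq _.
exists (Ordinal jb); apply/orP; right; rewrite /matched wi /= neq /=.
have hr := height_recr w (Ordinal jb); rewrite /= in hr.
have lj := low j.+1; rewrite neq leqnn in lj; have {}lj := lj isT.
case: (tnth _ _) hr => hr /=; last by lia.
have e : height w i.+1 = height w j by lia.
rewrite e eqxx /=; apply/forallP => l; apply/implyP; rewrite -e; exact: low.
Qed.

Lemma tunneling_neq n w (i : 'I_(2 * n)) : @dyck n w -> tunneling w i != i.
Proof.
move=> D; have [j ij] := dyck_matched i D; rewrite permE (partnerE ij).
apply/eqP => e; move: ij; rewrite e orbb => /and3P[_ _ /andP[]].
by rewrite ltnn.
Qed.

(* With 0-based positions, sigma_[k+1] is the image of {0, ..., k}. *)
Definition perm_path (m : nat) (s : 'S_m) (w : m.-tuple bool) : m.-tuple bool :=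
  [tuple tunneling w (s k) \notin [set s j | j : 'I_m & j <= k] | k < m].

(* {a, ..., a + k - 1} modulo m; k is intended to be at most m. *)
Definition circ_interval (m : nat) (a : 'I_m) (k : nat) : {set 'I_m} :=
  [set i : 'I_m | [exists j : 'I_k, (a + j) %% m == i]].

Definition unpaired (m : nat) (w : m.-tuple bool) (S : {set 'I_m}) : {set 'I_m} :=
  [set i in S | tunneling w i \notin S].

(* Main.v *)
Require Import Defs.
From mathcomp Require Import all_boot all_order all_fingroup all_algebra.
From mathcomp Require Import zify.

(** The height of [sigma(P)] after [k] steps is the number of unpaired steps in
    [sigma_[k]], for every permutation [sigma]: adding [sigma_k] to the set
    either creates one unpaired step or pairs off its partner.  Choosing for
    [sigma] the rotation by [a], the set [sigma_[k]] is the circular interval. *)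

(** With 0-based positions this is sigma_[k]; the strict bound makes it empty at [k = 0], where the
    induction starts. *)
Definition prefix_set {m : nat} (s : 'S_m) (k : nat) : {set 'I_m} :=
  [set s j | j : 'I_m & j < k].

Lemma prefix_set0 (m : nat) (s : 'S_m) : prefix_set s 0 = set0.
Proof. by apply/setP=> i; rewrite inE; apply/imsetP=> -[j]; rewrite inE. Qed.

Lemma mem_prefix_set (m : nat) (s : 'S_m) (k : nat) (i : 'I_m) :
  (s i \in prefix_set s k) = (i < k).
Proof. by rewrite mem_imset ?inE //; apply: perm_inj. Qed.

Lemma prefix_setS (m : nat) (s : 'S_m) (i : 'I_m) :
  prefix_set s i.+1 = s i |: prefix_set s i.
Proof.
apply/setP=> y; rewrite -(permKV s y) !inE !mem_prefix_set ltnS leq_eqVlt.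
by rewrite (inj_eq perm_inj).
Qed.

Lemma unpaired0 (m : nat) (w : m.-tuple bool) : unpaired w set0 = set0.
Proof. by apply/setP=> i; rewrite !inE. Qed.

(** Since [tunneling w] is an involution, no step of [S] has [x] as its partner, so no step of [S]
    changes status. *)
Lemma unpairedU1_notin (m : nat) (w : m.-tuple bool) (S : {set 'I_m}) x :
  tunneling w x \notin x |: S -> unpaired w (x |: S) = x |: unpaired w S.
Proof.
move=> tx; apply/setP=> i; rewrite !inE.
have [->|ix] /= := eqVneq i x; first by move: tx; rewrite !inE.
case iS: (i \in S) => //=; rewrite negb_or; case: eqVneq => //= ti.
by move: tx; rewrite -ti tunnelingK !inE iS orbT.
Qed.

(** The new step [x] is paired at once, and its partner is the only step of [S] that stops being
    unpaired. *)
Lemma unpairedU1_in (m : nat) (w : m.-tuple bool) (S : {set 'I_m}) x :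
  x \notin S -> tunneling w x \in S ->
  unpaired w (x |: S) = unpaired w S :\ tunneling w x.
Proof.
move=> xS tx; apply/setP=> i; rewrite !inE.
have [->|ix] /= := eqVneq i x.
  by rewrite (negbTE xS) tx orbT andbF.
rewrite negb_or (can2_eq (tunnelingK w) (tunnelingK w)).
by rewrite andbCA.
Qed.

Lemma height_perm_path (n : nat) (s : 'S_(2 * n)) (P : (2 * n).-tuple bool)
    (k : nat) : dyck P -> k <= 2 * n ->
  height (perm_path s P) k = Posz #|unpaired P (prefix_set s k)|.
Proof.
move=> D; elim: k => [|k IH] hk.
  by rewrite prefix_set0 unpaired0 cards0 /height take0.
pose i := Ordinal hk; have := height_recr (perm_path s P) i.
rewrite [nat_of_ord i]/= => ->; rewrite {}IH 1?ltnW // tnth_mktuple.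
have -> : [set s j | j : 'I_(2 * n) & j <= i] = prefix_set s i.+1 by [].
have si : s i \notin prefix_set s i by rewrite mem_prefix_set ltnn.
rewrite -[X in prefix_set s X.+1]/(nat_of_ord i) prefix_setS.
case: ifPn => tx.
  rewrite unpairedU1_notin // cardsU1 inE (negbTE si) /=; lia.
(* [perm_path] tests membership in a prefix that already contains [s i]; as a Dyck path's tunneling
   has no fixed point, the partner lies in the earlier prefix. *)
have {}tx : tunneling P (s i) \in prefix_set s i.
  by move: tx; rewrite negbK !inE (negbTE (tunneling_neq (s i) D)).
rewrite unpairedU1_in //.
(* The partner was unpaired so far, because [s i] is new; removing it lowers the cardinality by
   exactly one. *)
rewrite [in LHS](cardsD1 (tunneling P (s i))) inE tx tunnelingK si /=; lia.
Qed.

Lemma rotation_subproof {m : nat} (a j : 'I_m) : (a + j) %% m < m.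
Proof. by rewrite ltn_pmod // (leq_ltn_trans _ (ltn_ord a)). Qed.

Definition rotation_fun {m : nat} (a j : 'I_m) : 'I_m :=
  Ordinal (rotation_subproof a j).

Lemma rotation_inj {m : nat} (a : 'I_m) : injective (rotation_fun a).
Proof.
move=> i j /(congr1 val)/= /eqP; rewrite eqn_modDl !modn_small // => /eqP.
exact: val_inj.
Qed.

Definition rotation {m : nat} (a : 'I_m) : 'S_m := perm (rotation_inj a).

Lemma prefix_set_rotation (m : nat) (a : 'I_m) (k : nat) :
  k <= m -> prefix_set (rotation a) k = circ_interval a k.
Proof.
move=> km; apply/setP=> i; rewrite inE; apply/imsetP/existsP=> [[j]|[j /eqP ji]].
  by rewrite inE => jk ->; exists (Ordinal jk); rewrite permE.
(* The bound [k <= m] makes each offset below [k] a valid argument of the rotation. *)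
exists (widen_ord km j); first by rewrite inE /=.
by apply: val_inj; rewrite permE /= ji.
Qed.

Theorem theorem8 (n : nat) (hn : 1 <= n) (a : 'I_(2 * n)) (k : nat)
    (hk : 1 <= k <= 2 * n) :
  exists sigma : 'S_(2 * n),
    forall P : (2 * n).-tuple bool, dyck P ->
      Posz #|unpaired P (circ_interval a k)| = height (perm_path sigma P) k.
Proof.
have /andP[_ k2n] := hk; exists (rotation a) => P D.
by rewrite height_perm_path // prefix_set_rotation.
Qed.
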